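(* There exists a firmly non-expansive operator $T:\mathbb{R}^2\to\mathbb{R}^2$ (with the Euclidean inner product) such that $0\in\overline{\mathrm{ran}(I-T)}\setminus\mathrm{ran}(I-T)$ (in particular $T$ has no fixed point) and such that the sequence defined by $x^0=0$, $x^{k+1}=T(x^k)$ for $k\ge 0$, satisfies $\|x^k\|\to\infty$ but has no cosmic limit, i.e. the sequence $(1/\|x^k\|)x^k$ does not converge as $k\to\infty$.
   Context: An operator $T:\mathcal{H}\to\mathcal{H}$ on a real Hilbert space is non-expansive if $\|T(x)-T(y)\|\le\|x-y\|$ for all $x,y$, and firmly non-expansive if $\|T(x)-T(y)\|^2\le\langle x-y,T(x)-T(y)\rangle$ for all $x,y$. $I$ is the identity, $\mathrm{ran}(I-T)=\{x-T(x): x\in\mathcal{H}\}$, and the bar denotes closure. When $\|x^k\|\to\infty$, the vectors $x^k$ are non-zero for all large $k$, and $(1/\|x^k\|)x^k$ is considered for such $k$. *)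

(* Defs.v *)
From HB Require Import structures.
From mathcomp Require Import all_boot all_order all_algebra.
From mathcomp Require Import all_classical all_reals all_analysis.

Set Implicit Arguments.
Unset Strict Implicit.
Unset Printing Implicit Defensive.

Import Order.TTheory GRing.Theory Num.Theory.
Import numFieldNormedType.Exports.

Local Open Scope classical_set_scope.
Local Open Scope ring_scope.

(* The library norm `|x| on 'rV[R]_n is the sup norm, so the Euclidean inner
   product and norm are defined here. Closures and limits below refer to the
   library topology of 'rV[R]_n, which is the product topology and hence the
   one induced by the Euclidean norm. *)
Definition dot (R : realType) (n : nat) (x y : 'rV[R]_n) : R :=
  \sum_(i < n) x 0 i * y 0 i.

Definition enorm (R : realType) (n : nat) (x : 'rV[R]_n) : R :=
  Num.sqrt (dot x x).

Definition firmly_nonexpansive (R : realType) (n : nat)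
    (T : 'rV[R]_n -> 'rV[R]_n) : Prop :=
  forall x y : 'rV[R]_n, enorm (T x - T y) ^+ 2 <= dot (x - y) (T x - T y).

Definition displacement_range (R : realType) (n : nat)
    (T : 'rV[R]_n -> 'rV[R]_n) : set 'rV[R]_n :=
  range (fun x : 'rV[R]_n => x - T x).

(* Terms with x k = 0 are sent to 0 (since 0^-1 = 0); if the norms tend to
   infinity there are only finitely many of them. *)
Definition normalized (R : realType) (n : nat) (x : nat -> 'rV[R]_n) :
    nat -> 'rV[R]_n :=
  fun k => (enorm (x k))^-1 *: x k.

Definition has_cosmic_limit (R : realType) (n : nat)
    (x : nat -> 'rV[R]_n) : Prop :=
  exists l : 'rV[R]_n, normalized x k @[k --> \oo] --> l.

(* Main.v *)
Require Import Defs.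
From mathcomp Require Import all_boot all_order all_algebra.
From mathcomp Require Import all_classical all_reals all_analysis.
From mathcomp Require Import zify ring lra.
Set Implicit Arguments.
Unset Strict Implicit.
Unset Printing Implicit Defensive.
Import Order.TTheory GRing.Theory Num.Theory.
Import numFieldNormedType.Exports.
Local Open Scope classical_set_scope.
Local Open Scope ring_scope.

(** Take [T (x, y) = (A x, B y)], where [A] and [B] are nondecreasing and
    1-Lipschitz maps of the line with [x < A x] and [y < B y]: such a [T] is
    firmly nonexpansive and fixed-point free. Any unbounded sequence starting
    at 0 with positive nonincreasing increments is an orbit of such a map, so
    the two coordinates of the orbit of 0 can be prescribed independently. The
    second one is [sqrt k]; the first one is a piecewise linear concave
    sequence whose ratio to [sqrt k] tends to 5 along [k = 16^j] and to 4 along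
    [k = 4 * 16^j]. A cosmic limit would then have both slopes. *)

(** * Maps of the line with a prescribed orbit *)

Section Interpolation.
Context {R : realType} (d : nat -> R).

Definition partial_sum (k : nat) : R := \sum_(i < k) d i.

(* At [x = partial_sum j] the supremum is attained for [k = j]. *)
Definition orbit_map (x : R) : R :=
  sup (range (fun k => Num.min (partial_sum k.+1) (x + d k))).

Hypothesis d_gt0 : forall k, 0 < d k.
Hypothesis d_nincr : forall m n, (m <= n)%N -> d n <= d m.
Hypothesis d_unbounded : forall M, exists k, M < partial_sum k.

Lemma partial_sum0 : partial_sum 0 = 0.
Proof. by rewrite /partial_sum big_ord0. Qed.

Lemma partial_sumS k : partial_sum k.+1 = partial_sum k + d k.
Proof. by rewrite /partial_sum big_ord_recr. Qed.

Lemma le_partial_sum m n : (m <= n)%N -> partial_sum m <= partial_sum n.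
Proof.
elim: n => [|n IH]; first by rewrite leqn0 => /eqP ->.
rewrite leq_eqVlt => /predU1P[->//|]; rewrite ltnS => /IH h.
by rewrite partial_sumS (le_trans h)// lerDl ltW.
Qed.

Lemma orbit_map_has_ubound x :
  has_ubound (range (fun k => Num.min (partial_sum k.+1) (x + d k))).
Proof.
exists (x + d 0%N) => _ [k _ <-].
by rewrite ge_min lerD2l d_nincr ?orbT.
Qed.

Lemma orbit_map_ge x k : Num.min (partial_sum k.+1) (x + d k) <= orbit_map x.
Proof. by apply: ub_le_sup; [exact: orbit_map_has_ubound|exists k]. Qed.

Lemma orbit_map_le x z :
  (forall k, Num.min (partial_sum k.+1) (x + d k) <= z) -> orbit_map x <= z.
Proof.
move=> h; apply: ge_sup; last by move=> _ [k _ <-].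
by exists (Num.min (partial_sum 1) (x + d 0%N)), 0%N.
Qed.

(** Every term of the supremum is nondecreasing and 1-Lipschitz in [x]; the supremum inherits both
    properties, here and in the next lemma. *)
Lemma orbit_map_monotone x y : x <= y -> orbit_map x <= orbit_map y.
Proof.
move=> xy; apply: orbit_map_le => k; apply: le_trans (orbit_map_ge y k).
by rewrite le_min !ge_min lexx lerD2r xy orbT.
Qed.

Lemma orbit_map_lipschitz x y :
  x <= y -> orbit_map y <= orbit_map x + (y - x).
Proof.
move=> xy; apply: orbit_map_le => k.
rewrite -lerBlDr; apply: le_trans (orbit_map_ge x k).
by rewrite le_min !lerBlDr !ge_min; apply/andP; split; apply/orP;
  [left|right]; lra.
Qed.

(** Once [partial_sum k] exceeds [x], both arguments of the [k]-th minimum do. *)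
Lemma orbit_map_gt x : x < orbit_map x.
Proof.
have [k xk] := d_unbounded x; apply: lt_le_trans (orbit_map_ge x k).
rewrite lt_min ltrDl d_gt0 andbT (lt_le_trans xk)//.
exact: le_partial_sum.
Qed.

Lemma orbit_map_partial_sum k : orbit_map (partial_sum k) = partial_sum k.+1.
Proof.
apply/le_anti/andP; split; last first.
  by have := orbit_map_ge (partial_sum k) k; rewrite -partial_sumS minxx.
apply: orbit_map_le => i; rewrite ge_min (partial_sumS k) lerD2l.
(* Up to index [k] the cap [partial_sum i.+1] gives the bound; beyond it, the smaller increment
   [d i] does. *)
have [ik|ki] := leqP i k; last by rewrite d_nincr ?orbT// ltnW.
by rewrite -(partial_sumS k) le_partial_sum.
Qed.

(** On the line, monotone and 1-Lipschitz give firmly nonexpansive: for [x <= y] the image gap lies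
    between 0 and [y - x]. *)
Lemma orbit_map_firmly_nonexpansive x y :
  (orbit_map x - orbit_map y) ^+ 2 <= (x - y) * (orbit_map x - orbit_map y).
Proof.
wlog xy : x y / x <= y => [h|].
  have [/h//|/ltW/h] := leP x y.
  by rewrite -sqrrN opprB -mulrNN !opprB.
have := @orbit_map_monotone _ _ xy; have := @orbit_map_lipschitz _ _ xy.
by move: (orbit_map x) (orbit_map y) => u v; nra.
Qed.

End Interpolation.

(** * The two increment sequences and their partial sums *)

Section Increments.
Context {R : realType}.

(* The step is 4^-j for 16^j <= k < 16^(j+1), and 1 for k = 0, where
   [trunc_log] is 0. *)
Definition block_incr (k : nat) : R := 4^-1 ^+ trunc_log 16 k.

Definition sqrt_incr (k : nat) : R := Num.sqrt k.+1%:R - Num.sqrt k%:R.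

Lemma block_incr_gt0 k : 0 < block_incr k.
Proof. by rewrite exprn_gt0// invr_gt0. Qed.

Lemma block_incr_nincr m n : (m <= n)%N -> block_incr n <= block_incr m.
Proof.
move=> mn; apply: ler_wiXn2l; first by rewrite invr_ge0.
  by rewrite invf_le1// ler1n.
exact: leq_trunc_log.
Qed.

(** The step is constant on a block. The right endpoint is allowed because its sum only involves
    increments of smaller index. *)
Lemma partial_sum_block_incr j m : (16 ^ j <= m <= 16 ^ j.+1)%N ->
  partial_sum block_incr m =
  partial_sum block_incr (16 ^ j) + (m - 16 ^ j)%:R * 4^-1 ^+ j.
Proof.
elim: m => [|m IH]; first by rewrite leqn0 expn_eq0.
move=> /andP[]; rewrite leq_eqVlt => /predU1P[<- _|].
  by rewrite subnn mul0r addr0.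
rewrite ltnS => jm mj; rewrite partial_sumS IH ?jm ?(ltnW mj)//.
rewrite /block_incr (@trunc_log_eq _ j)// ?jm//.
by rewrite subSn// -natr1; ring.
Qed.

Lemma mul16X_invX j : (16 ^ j)%:R * 4^-1 ^+ j = 4 ^+ j :> R.
Proof.
rewrite natrX -exprMn; congr (_ ^+ _).
by field.
Qed.

(** Block [j] has [15 * 16^j] steps of size [4^-j], so it adds [15 * 4^j = 5 * (4^(j+1) - 4^j)]; the
    constant [-4] comes from the value 1 at [j = 0]. *)
Lemma partial_sum_block_incr16X j :
  partial_sum block_incr (16 ^ j) = 5 * 4 ^+ j - 4.
Proof.
elim: j => [|j IH].
  rewrite expn0 partial_sumS partial_sum0 /block_incr trunc_log0 !expr0; lra.
rewrite (@partial_sum_block_incr j) ?leqnn ?leq_exp2l ?leqnSn// IH.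
rewrite (_ : 16 ^ j.+1 - 16 ^ j = 15 * 16 ^ j)%N; last by rewrite expnS; lia.
by rewrite natrM -mulrA mul16X_invX exprS; ring.
Qed.

Lemma partial_sum_block_incr4M16X j :
  partial_sum block_incr (4 * 16 ^ j) = 8 * 4 ^+ j - 4.
Proof.
rewrite (@partial_sum_block_incr j); last first.
  by rewrite expnS leq_pmull// leq_mul2r orbT.
rewrite (_ : 4 * 16 ^ j - 16 ^ j = 3 * 16 ^ j)%N; last by lia.
by rewrite partial_sum_block_incr16X natrM -mulrA mul16X_invX; ring.
Qed.

Lemma partial_sum_sqrt_incr k : partial_sum sqrt_incr k = Num.sqrt k%:R.
Proof.
elim: k => [|k IH]; first by rewrite partial_sum0 sqrtr0.
by rewrite partial_sumS IH addrC subrK.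
Qed.

Lemma sqrt_incr_gt0 k : 0 < sqrt_incr k.
Proof. by rewrite subr_gt0 ltr_sqrt ?ltr0n// ltr_nat. Qed.

(** The conjugate form makes the decrease in [k] visible. *)
Lemma sqrt_incrE k :
  sqrt_incr k = (Num.sqrt k.+1%:R + Num.sqrt k%:R)^-1.
Proof.
have h : 0 < Num.sqrt k.+1%:R + Num.sqrt k%:R :> R.
  by rewrite ltr_wpDr ?sqrtr_ge0// sqrtr_gt0 ltr0n.
apply: (mulIf (lt0r_neq0 h)); rewrite mulVf ?lt0r_neq0// /sqrt_incr -subr_sqr.
by rewrite !sqr_sqrtr ?ler0n// -natr1 addrAC subrr add0r.
Qed.

Lemma sqrt_incr_nincr m n : (m <= n)%N -> sqrt_incr n <= sqrt_incr m.
Proof.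
move=> mn; have pos k : 0 < Num.sqrt k.+1%:R + Num.sqrt k%:R :> R.
  by rewrite ltr_wpDr ?sqrtr_ge0// sqrtr_gt0 ltr0n.
by rewrite !sqrt_incrE lef_pV2 ?posrE// lerD// ler_wsqrtr// ler_nat.
Qed.

Lemma sqrt16X j : Num.sqrt (16 ^ j)%:R = 4 ^+ j :> R.
Proof.
rewrite (_ : (16 ^ j)%:R = (4 ^+ j) ^+ 2); last first.
  by rewrite natrX exprAC; congr (_ ^+ _); ring.
by rewrite sqrtr_sqr ger0_norm// exprn_ge0.
Qed.

Lemma sqrt4M16X j : Num.sqrt (4 * 16 ^ j)%:R = 2 * 4 ^+ j :> R.
Proof.
rewrite natrM sqrtrM// sqrt16X (_ : 4%:R = 2 ^+ 2 :> R); last by ring.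
by rewrite sqrtr_sqr ger0_norm.
Qed.

Lemma sqrt_incr16X_le j : sqrt_incr (16 ^ j) <= 4^-1 ^+ j.
Proof.
have h : 0 < 4 ^+ j :> R by rewrite exprn_gt0.
rewrite sqrt_incrE exprVn sqrt16X lef_pV2 ?posrE// ?ltr_wpDl ?sqrtr_ge0//.
by rewrite lerDr sqrtr_ge0.
Qed.

Lemma exists_4X_gt (M : R) : exists j, M < 4 ^+ j.
Proof.
exists (Num.bound `|M|); apply: (le_lt_trans (ler_norm M)).
apply: (lt_le_trans (archi_boundP (normr_ge0 M))).
by rewrite -natrX ler_nat ltnW// ltn_expl.
Qed.

Lemma block_incr_unbounded M : exists k, M < partial_sum block_incr k.
Proof.
have [j Mj] := exists_4X_gt (`|M| + 4).
exists (16 ^ j)%N; rewrite partial_sum_block_incr16X.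
by have := ler_norm M; have := normr_ge0 M; lra.
Qed.

End Increments.

(** * Euclidean geometry of the plane and constraints on a cosmic limit *)

Lemma dot2E (R : realType) (x y : 'rV[R]_2) :
  dot x y = x 0 0 * y 0 0 + x 0 1 * y 0 1.
Proof.
by rewrite /dot big_ord_recl big_ord1; congr (_ + _ * _);
  congr (_ _ _); apply: val_inj.
Qed.

Lemma sqr_enorm (R : realType) (n : nat) (x : 'rV[R]_n) :
  enorm x ^+ 2 = dot x x.
Proof. by rewrite sqr_sqrtr// sumr_ge0// => i _; rewrite -expr2 sqr_ge0. Qed.

Lemma ord2_cases (i : 'I_2) : i = 0 \/ i = 1.
Proof. by case: i => -[|[|//]] ?; [left|right]; apply: val_inj. Qed.

(* Passing to the limit along [phi] in [(c y - x) / |(x, y)| = m / |(x, y)|]. *)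
Lemma cosmic_limit_slope (R : realType) (x : nat -> 'rV[R]_2) (l : 'rV[R]_2)
    (phi : nat -> nat) (c m : R) :
  enorm (x k) @[k --> \oo] --> +oo ->
  normalized x k @[k --> \oo] --> l ->
  phi j @[j --> \oo] --> \oo ->
  (forall j, c * x (phi j) 0 1 - x (phi j) 0 0 = m) ->
  c * l 0 1 = l 0 0.
Proof.
move=> xoo xl phioo xm; apply/eqP; rewrite -subr_eq0; apply/eqP.
have u0 : (enorm (x k))^-1 @[k --> \oo] --> (0 : R).
  by apply/gtr0_cvgV0 => //; move/cvgryPgt : xoo; apply.
have coord i : normalized x (phi j) 0 i @[j --> \oo] --> l 0 i.
  apply: (cvg_comp phi (fun k => normalized x k 0 i) phioo).
  apply: (cvg_comp (normalized x) (fun v : 'rV[R]_2 => v 0 i) xl).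
  exact: coord_continuous.
apply: (@cvg_unique _ (@Rhausdorff R)
  ((fun j => c * normalized x (phi j) 0 1 - normalized x (phi j) 0 0) @ \oo)).
  by apply: cvgB (coord 0); apply: cvgMl_tmp (coord 1).
rewrite (_ : (fun _ => _) = (fun j => (enorm (x (phi j)))^-1 * m)).
  rewrite -(mul0r m); apply: cvgMr_tmp; exact: (cvg_comp phi _ phioo u0).
by apply/funext => j; rewrite !mxE -(xm j); ring.
Qed.

(** This excludes [l = 0], the only vector compatible with two different slopes. *)
Lemma cosmic_limit_unit (R : realType) (x : nat -> 'rV[R]_2) (l : 'rV[R]_2) :
  enorm (x k) @[k --> \oo] --> +oo ->
  normalized x k @[k --> \oo] --> l ->
  l 0 0 ^+ 2 + l 0 1 ^+ 2 = 1.
Proof.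
move=> xoo xl.
have coord i : normalized x j 0 i @[j --> \oo] --> l 0 i.
  apply: (cvg_comp (normalized x) (fun v : 'rV[R]_2 => v 0 i) xl).
  exact: coord_continuous.
apply: (@cvg_unique _ (@Rhausdorff R)
  ((fun j => normalized x j 0 0 ^+ 2 + normalized x j 0 1 ^+ 2) @ \oo)).
  apply: cvgD; rewrite expr2; under eq_fun do rewrite expr2;
    by apply: cvgM; exact: coord.
apply: cvg_near_cst.
(* Only indices with nonzero norm matter, so the value 0 given to normalized zero vectors is
   harmless. *)
have /cvgryPgt/(_ 0) := xoo; apply: filterS => k xk.
rewrite !mxE !exprMn -mulrDr !expr2 -dot2E -sqr_enorm -expr2 -exprMn.
rewrite mulVf ?expr1n//.
exact: lt0r_neq0.
Qed.

(** * The product operator on the plane and its orbit from 0 *)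

Theorem mainTheorem1 (R : realType) :
  exists T : 'rV[R]_2 -> 'rV[R]_2,
    [/\ firmly_nonexpansive T,
        (closure (displacement_range T) `\` displacement_range T) 0,
        (forall x : 'rV[R]_2, T x <> x) &
        forall x : nat -> 'rV[R]_2,
          x 0%N = 0 -> (forall k : nat, x k.+1 = T (x k)) ->
          enorm (x k) @[k --> \oo] --> +oo /\ ~ has_cosmic_limit x].
Proof.
pose A := orbit_map (@block_incr R); pose B := orbit_map (@sqrt_incr R).
pose T (v : 'rV[R]_2) : 'rV[R]_2 :=
  \row_j if j == 0 then A (v 0 0) else B (v 0 1).
have T0 v : T v 0 0 = A (v 0 0) by rewrite mxE.
have T1 v : T v 0 1 = B (v 0 1) by rewrite mxE.
have A_gt t : t < A t.
  exact: (orbit_map_gt block_incr_gt0 block_incr_nincr block_incr_unbounded).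
have Tfix v : T v <> v.
  move=> /(congr1 (fun w : 'rV_2 => w 0 0)); rewrite T0 => /eqP.
  by rewrite gt_eqF.
exists T; split => //.
- move=> x y; rewrite sqr_enorm !dot2E !(T0, T1, mxE) -!expr2.
  apply: lerD.
    exact: (orbit_map_firmly_nonexpansive block_incr_nincr).
  exact: (orbit_map_firmly_nonexpansive sqrt_incr_nincr).
- split; last by move=> [v _ /subr0_eq/esym]; exact: Tfix.
  move=> U /nbhs_ballP[e /= e0 eU].
  (* The orbit point of index [16^j] is displaced by at most [4^-j < e] in each coordinate, and
     balls of row vectors are coordinatewise. *)
  have [j ej] := exists_4X_gt e^-1.
  have [v [v0 v1]] : exists v : 'rV[R]_2,
      v 0 0 = partial_sum block_incr (16 ^ j) /\
      v 0 1 = partial_sum sqrt_incr (16 ^ j).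
    by exists (\row_i if i == 0 then partial_sum block_incr (16 ^ j)
                       else partial_sum sqrt_incr (16 ^ j)); rewrite !mxE.
  exists (v - T v); split; first by exists v.
  have small : 4^-1 ^+ j < e by rewrite exprVn invf_plt ?posrE// exprn_gt0.
  have dA : A (v 0 0) = v 0 0 + block_incr (16 ^ j).
    rewrite v0 -partial_sumS.
    exact: (orbit_map_partial_sum block_incr_gt0 block_incr_nincr).
  have dB : B (v 0 1) = v 0 1 + sqrt_incr (16 ^ j).
    rewrite v1 -partial_sumS.
    exact: (orbit_map_partial_sum sqrt_incr_gt0 sqrt_incr_nincr).
  apply: eU; split=> // i k; apply: le_lt_trans small.
  rewrite ord1 mxE sub0r normrN.
  have [->|->] := ord2_cases k;
    rewrite !mxE/= ?dA ?dB opprD ?addKr ?addNKr normrN.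
    by rewrite gtr0_norm ?block_incr_gt0// /block_incr trunc_expnK.
  by rewrite gtr0_norm ?sqrt_incr_gt0// sqrt_incr16X_le.
move=> x x0 xS.
have xE k : x k 0 0 = partial_sum block_incr k /\ x k 0 1 = Num.sqrt k%:R.
  elim: k => [|k [IH0 IH1]].
    by rewrite x0 !mxE partial_sum0 sqrtr0.
  rewrite xS T0 T1 IH0 IH1 -!partial_sum_sqrt_incr; split.
    exact: (orbit_map_partial_sum block_incr_gt0 block_incr_nincr).
  exact: (orbit_map_partial_sum sqrt_incr_gt0 sqrt_incr_nincr).
have xoo : enorm (x k) @[k --> \oo] --> +oo.
  (* The second coordinate [sqrt k] bounds the norm from below, so [k >= M^2] suffices. *)
  apply/cvgryPge => M; have /cvgryPge/(_ (M ^+ 2)) := @cvgr_idn R.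
  apply: filterS => k Mk; rewrite (le_trans (ler_norm M))// -sqrtr_sqr.
  rewrite ler_wsqrtr// dot2E (xE k).2 -!expr2 sqr_sqrtr ?ler0n//.
  by rewrite (le_trans Mk)// lerDr sqr_ge0.
split => // -[l xl].
have phioo c : (0 < c)%N -> (c * 16 ^ j)%N @[j --> \oo] --> \oo.
  move=> c0; apply/cvgnyPge => N; exists N => //= j Nj.
  rewrite (leq_trans Nj)// (leq_trans (ltnW (@ltn_expl 16 j isT)))//.
  by rewrite leq_pmull.
(* Here [5 * 4^j - (5 * 4^j - 4) = 4]; in [slope4], [4 * (2 * 4^j) - (8 * 4^j - 4) = 4]. *)
have slope5 : 5 * l 0 1 = l 0 0.
  apply: (cosmic_limit_slope (m := 4) xoo xl (phioo 1%N isT)) => j.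
  by rewrite mul1n !(xE _).1 !(xE _).2 partial_sum_block_incr16X sqrt16X; ring.
have slope4 : 4 * l 0 1 = l 0 0.
  apply: (cosmic_limit_slope (m := 4) xoo xl (phioo 4%N isT)) => j.
  by rewrite !(xE _).1 !(xE _).2 partial_sum_block_incr4M16X sqrt4M16X; ring.
(* The two slopes force both coordinates of [l] to vanish, against unit norm. *)
have := cosmic_limit_unit xoo xl; nra.
Qed.
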